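(* Let $0\le\alpha<1$ and $0<\beta\le 1$. Let $p,b,c\in\mathbb{C}$ be such that $c$ is real with $c<0$ and $p+\frac{b+1}{2}$ is real with $p+\frac{b+1}{2}>0$. Assume that $$2\beta(1-\alpha)\left(1+\frac{p+\frac{b+1}{2}+1}{p+\frac{b+1}{2}}\right)e^{\frac{c}{p+\frac{b+1}{2}+1}}-\left(\frac{(1+\beta)c^{2}}{\left(p+\frac{b+1}{2}\right)\left(p+\frac{b+1}{2}+1\right)}-\frac{2\left(1+\beta(2-\alpha)\right)c}{p+\frac{b+1}{2}}+\frac{2\beta(1-\alpha)\left(p+\frac{b+1}{2}+1\right)}{p+\frac{b+1}{2}}\right)\ \ge\ 0 .$$ Then $u_{p,b,c}\in K(\alpha,\beta)$.
   Context: $U=\{z\in\mathbb{C}:|z|<1\}$ and $\mathcal{A}$ is the class of analytic functions $f$ on $U$ of the form $f(z)=z+\sum_{k=2}^{\infty}a_kz^k$. For $0\le\alpha<1$, $0<\beta\le1$, $K(\alpha,\beta)$ is the class of $f\in\mathcal{A}$ satisfying $\left|\dfrac{\frac{zf''(z)}{f'(z)}}{\frac{zf''(z)}{f'(z)}+2(1-\alpha)}\right|<\beta$ for all $z\in U$. The normalized generalized Bessel function is $$u_{p,b,c}(z)=\sum_{k=0}^{\infty}\frac{(-c)^k}{\left(p+\frac{b+1}{2}\right)_k}\frac{z^{k+1}}{k!},\qquad p,b,c\in\mathbb{C},\ p+\tfrac{b+1}{2}\notin\{0,-1,-2,\dots\},$$ where $(\lambda)_0=1$ and $(\lambda)_k=\lambda(\lambda+1)\cdots(\lambda+k-1)$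 for $k\ge1$. *)

(* Defs.v *)
From Stdlib Require Import Reals Factorial.
From Coquelicot Require Import Coquelicot.

Open Scope R_scope.

Definition in_U (z : C) : Prop := Cmod z < 1.

Definition class_A (f : C -> C) : Prop :=
  (forall z : C, in_U z -> ex_derive (K := C_AbsRing) (V := C_NormedModule) f z) /\
  exists a : nat -> C, forall z : C, in_U z ->
    is_series (K := C_AbsRing) (V := C_NormedModule)
      (fun k : nat => (a (k + 2)%nat * z ^ (k + 2))%C) (f z - z)%C.

(** [C_derive] is a total operator that agrees with the complex derivative
    wherever the latter exists; by analyticity this is the case for [f] and for
    [C_derive f] at every point of the disk.  Division in [C] is total, so that
    the denominators are required to be nonzero explicitly. *)
Definition class_K (alpha beta : R) (f : C -> C) : Prop :=
  class_A f /\
  forall z : C, in_U z ->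
    let q := (z * C_derive (C_derive f) z / C_derive f z)%C in
    let d := (q + 2 * (1 - RtoC alpha))%C in
    C_derive f z <> RtoC 0 /\ d <> RtoC 0 /\ Cmod (q / d) < beta.

Fixpoint pochhammer (l : C) (k : nat) : C :=
  match k with
  | O => RtoC 1
  | S j => (pochhammer l j * (l + RtoC (INR j)))%C
  end.

(** Sum of a complex series, computed componentwise; it is the actual sum
    whenever the series converges in [C]. *)
Definition CSeries (a : nat -> C) : C :=
  (Series (fun k => Re (a k)), Series (fun k => Im (a k))).

Definition kappa (p b : C) : C := (p + (b + 1) / 2)%C.

(** Meaningful when [kappa p b] is not a nonpositive integer. *)
Definition bessel_u (p b c z : C) : C :=
  CSeries (fun k : nat =>
    ((- c) ^ k / pochhammer (kappa p b) k
      * (z ^ (k + 1) / RtoC (INR (fact k))))%C).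

(* Main.v *)
(** Write the function as z + sum_(n >= 2) a_n z^n and put D = 2 beta (1 - alpha).
    By the triangle inequality,
    |z f''| - beta |z f'' + 2 (1 - alpha) f'| < 0 on the disk as soon as
    sum_(n >= 2) n ((n - 1) (1 + beta) + D) |a_n| <= D, so this is a sufficient
    condition for membership in K(alpha, beta).
    For the Bessel function, (m)_n >= m (m + 1)^(n-1) bounds |a_(n+1)| by
    ((m + 1) / m) t^n / n! with t = - x / (m + 1).  The majorizing sum is an explicit
    multiple of exp t plus a constant, and its comparison with D is exactly the
    hypothesis multiplied by exp t. *)

Require Import Defs.
From Stdlib Require Import Reals Factorial Lra Lia.
From Coquelicot Require Import Coquelicot.
Open Scope R_scope.

Local Notation is_Cseries := (is_series (K := C_AbsRing) (V := C_NormedModule)).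
Local Notation is_Cderive := (is_derive (K := C_AbsRing) (V := C_NormedModule)).

(** * Convergence and modulus bounds for complex series *)

Lemma sum_n_C (a : nat -> C) (n : nat) :
  sum_n (G := C_NormedModule) a n =
  (sum_n (fun k => Re (a k)) n, sum_n (fun k => Im (a k)) n).
Proof.
  induction n as [|n IH].
  - rewrite !sum_O. now destruct (a 0%nat).
  - rewrite !sum_Sn, IH. reflexivity.
Qed.

Lemma is_Cseries_pair (a : nat -> C) (l : C) :
  is_series (fun k => Re (a k)) (Re l) ->
  is_series (fun k => Im (a k)) (Im l) ->
  is_Cseries a l.
Proof.
  intros Hre Him.
  apply filterlim_locally. intros eps.
  generalize (proj1 (filterlim_locally _ _) Hre eps)
             (proj1 (filterlim_locally _ _) Him eps).
  intros H1 H2.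
  generalize (filter_and _ _ H1 H2).
  apply filter_imp. intros n [B1 B2].
  rewrite sum_n_C. split; assumption.
Qed.

(** Real and imaginary parts are dominated by the modulus, so under absolute convergence the
    componentwise sum is the genuine complex sum. *)
Lemma is_Cseries_CSeries (a : nat -> C) :
  ex_series (fun k => Cmod (a k)) -> is_Cseries a (CSeries a).
Proof.
  intros H. apply is_Cseries_pair; apply Series_correct;
    refine (ex_series_le (V := R_CompleteNormedModule) _ _ _ H); intros n.
  - apply re_le_Cmod.
  - apply Rle_trans with (2 := Rmax_Cmod (a n)), Rmax_r.
Qed.

Lemma is_Cseries_Cmod_le (a : nat -> C) (m : nat -> R) (l : C) (M : R) :
  is_Cseries a l -> is_series m M -> (forall k, Cmod (a k) <= m k) ->
  Cmod l <= M.
Proof.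
  intros Ha Hm Hle.
  assert (Hn : forall n, Cmod (sum_n (G := C_NormedModule) a n) <= sum_n m n).
  { induction n as [|n IH].
    - rewrite !sum_O. apply Hle.
    - rewrite !sum_Sn. apply Rle_trans with (1 := Cmod_triangle _ _).
      apply Rplus_le_compat; [exact IH | apply Hle]. }
  assert (Hl : is_lim_seq (fun n => Cmod (sum_n (G := C_NormedModule) a n)) (Cmod l)).
  { refine (filterlim_comp _ _ _ _ _ _ _ _ Ha _).
    exact (filterlim_norm (V := C_NormedModule) l). }
  exact (is_lim_seq_le _ _ (Cmod l) M Hn Hl Hm).
Qed.

Lemma Series_ge_0 (a : nat -> R) :
  ex_series a -> (forall k, 0 <= a k) -> 0 <= Series a.
Proof.
  intros Hex Ha. apply Rle_trans with (Series (fun _ => 0 * 0)).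
  - rewrite Series_scal_l. lra.
  - apply Series_le; [|exact Hex]. intros n. generalize (Ha n). lra.
Qed.

(** * Complex power series and their termwise derivatives *)

Definition CPSeries (b : nat -> C) (z : C) : C := CSeries (fun k => b k * z ^ k)%C.

Definition CPS_derive (b : nat -> C) (k : nat) : C := (RtoC (INR (S k)) * b (S k))%C.

(** Radii are those of the real series of moduli; taking moduli turns [CPS_derive] into the real
    [PS_derive], which keeps the radius. *)
Lemma CV_radius_CPS_derive (b : nat -> C) :
  CV_radius (fun k => Cmod (CPS_derive b k)) = CV_radius (fun k => Cmod (b k)).
Proof.
  rewrite <- (CV_radius_derive (fun k => Cmod (b k))). apply CV_radius_ext. intros n.
  unfold CPS_derive, PS_derive.
  rewrite Cmod_mult, Cmod_R, Rabs_pos_eq; [easy | apply pos_INR].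
Qed.

Lemma is_Cseries_CPSeries (b : nat -> C) (z : C) :
  Rbar_lt (Cmod z) (CV_radius (fun k => Cmod (b k))) ->
  is_Cseries (fun k => (b k * z ^ k)%C) (CPSeries b z).
Proof.
  intros Hz. apply is_Cseries_CSeries.
  rewrite <- (Rabs_pos_eq (Cmod z)) in Hz by apply Cmod_ge_0.
  generalize (CV_disk_inside _ _ Hz). apply ex_series_ext. intros n.
  rewrite <- Cmod_pow, <- Cmod_mult. apply Rabs_pos_eq, Cmod_ge_0.
Qed.

(** Writing R_n for the remainder of the n-th power, R_(n+1) = w R_n + n z^(n-1) (w - z)^2. The
    induction then closes because n (n - 1) + n <= (n + 1) n. *)
Lemma Cpow_taylor2 (r : R) (z w : C) (k : nat) :
  Cmod z <= r -> Cmod w <= r ->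
  Cmod (w ^ k - z ^ k - RtoC (INR k) * z ^ (k - 1) * (w - z))%C
    <= INR k * INR (k - 1) * r ^ (k - 2) * Cmod (w - z) ^ 2.
Proof.
  intros Hz Hw.
  assert (Hr : 0 <= r) by (apply Rle_trans with (2 := Hz), Cmod_ge_0).
  (* Exponents 0 and 1, where the natural subtractions truncate, have zero remainder and are treated
     apart. *)
  destruct k as [|k].
  { simpl. replace (1 - 1 - 0 * 1 * (w - z))%C with (RtoC 0) by ring. rewrite Cmod_0. lra. }
  destruct k as [|k].
  { simpl. replace (w * 1 - z * 1 - 1 * 1 * (w - z))%C with (RtoC 0) by ring. rewrite Cmod_0. lra. }
  replace (S (S k) - 1)%nat with (S k) by lia.
  replace (S (S k) - 2)%nat with k by lia.
  set (h := Cmod (w - z)). assert (Hh : 0 <= h) by apply Cmod_ge_0.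
  induction k as [|k IH].
  - replace (w ^ 2 - z ^ 2 - RtoC (INR 2) * z ^ 1 * (w - z))%C with ((w - z) ^ 2)%C
      by (change (INR 2) with (1 + 1); rewrite RtoC_plus; ring).
    rewrite Cmod_pow. fold h. simpl. nra.
  - replace (w ^ S (S (S k)) - z ^ S (S (S k)) - RtoC (INR (S (S (S k)))) * z ^ S (S k) * (w - z))%C
      with (w * (w ^ S (S k) - z ^ S (S k) - RtoC (INR (S (S k))) * z ^ S k * (w - z))
            + RtoC (INR (S (S k))) * z ^ S k * (w - z) ^ 2)%C
      by (rewrite (S_INR (S (S k))), RtoC_plus, !Cpow_S; ring).
    eapply Rle_trans; [apply Cmod_triangle|].
    rewrite !Cmod_mult, !Cmod_pow, Cmod_R, (Rabs_pos_eq (INR _)) by apply pos_INR. fold h.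
    assert (H1 : Cmod z ^ S k <= r ^ S k) by (apply pow_incr; split; [apply Cmod_ge_0 | easy]).
    assert (H0 : 0 <= INR k) by apply pos_INR.
    assert (Hp : 0 <= r ^ k) by now apply pow_le.
    apply Rle_trans with
      (r * (INR (S (S k)) * INR (S k) * r ^ k * h ^ 2) + INR (S (S k)) * r ^ S k * h ^ 2).
    + apply Rplus_le_compat.
      * apply Rmult_le_compat; [apply Cmod_ge_0 | apply Cmod_ge_0 | easy | exact IH].
      * apply Rmult_le_compat_r; [nra|]. apply Rmult_le_compat_l; [apply pos_INR | easy].
    + rewrite !S_INR. simpl pow.
      assert (0 <= r * r ^ k * (h * (h * 1))) by (apply Rmult_le_pos; nra).
      nra.
Qed.

(* The remainder F(w) - F(z) - F'(z) (w - z) is summed termwise and is O(|w - z|^2),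
   so no uniform convergence argument is needed. *)
Lemma is_derive_CPSeries (b : nat -> C) (z : C) :
  Rbar_lt (Cmod z) (CV_radius (fun k => Cmod (b k))) ->
  is_Cderive (CPSeries b) z (CPSeries (CPS_derive b) z).
Proof.
  intros Hz.
  (* A radius strictly between |z| and the radius of convergence leaves room for the nearby points
     [w]. *)
  assert (Hr : exists r, Cmod z < r /\ Rbar_lt r (CV_radius (fun k => Cmod (b k)))).
  { destruct (CV_radius (fun k => Cmod (b k))) as [R| |]; simpl in Hz |- *.
    - exists ((Cmod z + R) / 2). lra.
    - exists (Cmod z + 1). split; [lra | easy].
    - easy. }
  destruct Hr as [r [Hzr HrR]].
  assert (Hr0 : 0 < r) by (generalize (Cmod_ge_0 z); lra).
  (* Apart from its two vanishing initial terms, [M] is the twice differentiated series of moduli at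
     [r], hence summable. *)
  set (M k := INR k * INR (k - 1) * Cmod (b k) * r ^ (k - 2)).
  assert (HM : ex_series M).
  { apply (ex_series_incr_n M 2).
    assert (H : Rbar_lt (Rabs r) (CV_radius (PS_derive (PS_derive (fun k => Cmod (b k)))))).
    { rewrite !CV_radius_derive, Rabs_pos_eq; [easy | lra]. }
    generalize (CV_disk_inside _ _ H). apply ex_series_ext. intros n.
    unfold M, PS_derive.
    replace (2 + n - 1)%nat with (S n) by lia.
    replace (2 + n - 2)%nat with n by lia.
    change (2 + n)%nat with (S (S n)).
    rewrite Rabs_pos_eq; [apply Rminus_diag_uniq; simpl; ring|].
    repeat apply Rmult_le_pos; try apply pos_INR; try apply Cmod_ge_0.
    apply pow_le; lra. }
  set (K := Series M).
  assert (HK : 0 <= K).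
  { apply Series_ge_0; [exact HM|]. intros n. unfold M.
    repeat apply Rmult_le_pos; try apply pos_INR; try apply Cmod_ge_0.
    apply pow_le; lra. }
  assert (Hrem : forall w, Cmod w <= r ->
    Cmod (CPSeries b w - CPSeries b z - (w - z) * CPSeries (CPS_derive b) z)%C
      <= K * Cmod (w - z) ^ 2).
  { intros w Hw.
    assert (Sw := is_Cseries_CPSeries b w (Rbar_le_lt_trans (Cmod w) r _ Hw HrR)).
    assert (Sz := is_Cseries_CPSeries b z Hz).
    assert (Sd : is_Cseries (fun k => (RtoC (INR k) * b k * z ^ (k - 1))%C)
                            (CPSeries (CPS_derive b) z)).
    { apply is_series_decr_1.
      replace (plus _ _) with (CPSeries (CPS_derive b) z).
      - refine (is_series_ext _ _ _ _ (is_Cseries_CPSeries (CPS_derive b) z _)).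
        + intros n. unfold CPS_derive. now replace (S n - 1)%nat with n by lia.
        + now rewrite CV_radius_CPS_derive.
      - change (@eq C (CPSeries (CPS_derive b) z)
          (CPSeries (CPS_derive b) z + - (0 * b 0%nat * 1))%C). ring. }
    assert (Sr := is_series_minus _ _ _ _ (is_series_minus _ _ _ _ Sw Sz)
                   (is_series_scal_l (w - z)%C _ _ Sd)).
    refine (is_Cseries_Cmod_le _ _ _ _ Sr
              (is_series_scal_r (Cmod (w - z) ^ 2) _ _ (Series_correct _ HM)) _).
    intros k.
    change (Cmod (b k * w ^ k - b k * z ^ k - (w - z) * (RtoC (INR k) * b k * z ^ (k - 1)))%C
              <= M k * Cmod (w - z) ^ 2).
    replace (b k * w ^ k - b k * z ^ k - (w - z) * (RtoC (INR k) * b k * z ^ (k - 1)))%C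
      with (b k * (w ^ k - z ^ k - RtoC (INR k) * z ^ (k - 1) * (w - z)))%C by ring.
    rewrite Cmod_mult. unfold M.
    replace (_ * _ * Cmod (b k) * _ * _) with
      (Cmod (b k) * (INR k * INR (k - 1) * r ^ (k - 2) * Cmod (w - z) ^ 2)) by ring.
    apply Rmult_le_compat_l; [apply Cmod_ge_0|].
    apply Cpow_taylor2; lra. }
  split; [apply is_linear_scal_l|].
  intros z' Hz'.
  rewrite <- (is_filter_lim_locally_unique _ _ Hz'). clear z' Hz'.
  intros eps.
  (* The first bound keeps [w] within radius [r], the second makes K |w - z| <= eps; [K + 1] keeps
     the denominator positive when [K] is 0. *)
  assert (Hd : 0 < Rmin (r - Cmod z) (eps / (K + 1))).
  { apply Rmin_case; [lra|]. apply Rdiv_lt_0_compat; [apply cond_pos | lra]. }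
  exists (mkposreal _ Hd). intros w Hw.
  change (Cmod (w - z) < Rmin (r - Cmod z) (eps / (K + 1))) in Hw.
  change (Cmod (CPSeries b w - CPSeries b z - (w - z) * CPSeries (CPS_derive b) z)%C
            <= eps * Cmod (w - z)).
  assert (H1 := Rmin_l (r - Cmod z) (eps / (K + 1))).
  assert (H2 := Rmin_r (r - Cmod z) (eps / (K + 1))).
  assert (Hwr : Cmod w <= r).
  { replace w with ((w - z) + z)%C by ring.
    apply Rle_trans with (1 := Cmod_triangle _ _). lra. }
  apply Rle_trans with (1 := Hrem w Hwr).
  assert (H3 : K * Cmod (w - z) <= eps).
  { replace (pos eps) with ((K + 1) * (eps / (K + 1))) by (field; lra).
    assert (0 <= Cmod (w - z)) by apply Cmod_ge_0. nra. }
  assert (0 <= Cmod (w - z)) by apply Cmod_ge_0. nra.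
Qed.

(** * The coefficient criterion for K(alpha, beta) *)

Lemma CV_radius_ge_1 (a : nat -> R) : ex_series a -> Rbar_le 1 (CV_radius a).
Proof.
  intros H. apply Rbar_not_lt_le. rewrite <- Rabs_R1. intros Hlt.
  (* Beyond the radius of convergence the terms cannot tend to zero, but at the point 1 they do. *)
  apply (CV_disk_outside _ _ Hlt).
  apply is_lim_seq_ext with a; [intros n; rewrite pow1; ring|].
  now apply ex_series_lim_0.
Qed.

Lemma ball_in_U (z : C) :
  in_U z -> locally (T := AbsRing_UniformSpace C_AbsRing) z in_U.
Proof.
  intros Hz. assert (Hd : 0 < 1 - Cmod z) by (unfold in_U in Hz; lra).
  exists (mkposreal _ Hd). intros w Hw.
  change (Cmod (w - z) < 1 - Cmod z) in Hw.
  unfold in_U. replace w with ((w - z) + z)%C by ring.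
  apply Rle_lt_trans with (1 := Cmod_triangle _ _). lra.
Qed.

(** Both z f'' and f' - 1 carry a factor |z| < 1, which turns the non-strict coefficient inequality
    into the strict one of the class. *)
Lemma class_K_of_coefficients (alpha beta : R) (b : nat -> C) (f : C -> C) :
  0 <= alpha < 1 -> 0 < beta ->
  b 0%nat = 0 -> b 1%nat = 1 ->
  (forall z, f z = CPSeries b z) ->
  let D := 2 * beta * (1 - alpha) in
  let s := fun k => INR (k + 2) * (INR (k + 1) * (1 + beta) + D) * Cmod (b (k + 2)%nat) in
  ex_series s -> Series s <= D ->
  class_K alpha beta f.
Proof.
  intros Halpha Hbeta Hb0 Hb1 Hf D s Hs HsD.
  assert (HD : 0 < D) by (unfold D; apply Rmult_lt_0_compat; lra).
  (* [s1] and [s2] are the coefficient moduli of f'' and of f' - 1; [s] is their combination with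
     weights 1 + beta and D. *)
  set (s1 := fun k => INR (k + 2) * INR (k + 1) * Cmod (b (k + 2)%nat)).
  set (s2 := fun k => INR (k + 2) * Cmod (b (k + 2)%nat)).
  assert (Hpos : forall k, 0 <= s1 k /\ 0 <= s2 k).
  { intros k. unfold s1, s2.
    split; repeat apply Rmult_le_pos; try apply pos_INR; apply Cmod_ge_0. }
  assert (Hs12 : forall k, s k = (1 + beta) * s1 k + D * s2 k)
    by (intros k; unfold s, s1, s2; ring).
  assert (Hex1 : ex_series s1).
  { apply (ex_series_le (V := R_CompleteNormedModule) _ s); [|exact Hs].
    intros k. destruct (Hpos k) as [P1 P2].
    change (Rabs (s1 k) <= s k). rewrite Rabs_pos_eq, Hs12 by easy. nra. }
  assert (Hex2 : ex_series s2).
  { apply (ex_series_le (V := R_CompleteNormedModule) _ (fun k => / D * s k)).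
    - intros k. destruct (Hpos k) as [P1 P2].
      change (Rabs (s2 k) <= / D * s k). rewrite Rabs_pos_eq, Hs12 by easy.
      apply Rmult_le_reg_l with D; [easy|].
      rewrite <- Rmult_assoc, Rinv_r, Rmult_1_l by lra. nra.
    - now apply (ex_series_scal_l (/ D) s). }
  set (S1 := Series s1). set (S2 := Series s2).
  assert (HS : (1 + beta) * S1 + D * S2 <= D).
  { unfold S1, S2. rewrite <- !Series_scal_l, <- Series_plus.
    - rewrite <- (Series_ext s) by exact Hs12. exact HsD.
    - now apply (ex_series_scal_l (1 + beta) s1).
    - now apply (ex_series_scal_l D s2). }
  assert (HS1 : 0 <= S1).
  { apply Series_ge_0; [exact Hex1|]. apply Hpos. }
  assert (Hrad : Rbar_le 1 (CV_radius (fun k => Cmod (b k)))).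
  { apply CV_radius_ge_1, (ex_series_incr_n _ 2).
    apply (ex_series_le (V := R_CompleteNormedModule) _ s2); [|exact Hex2].
    intros k. change (Rabs (Cmod (b (2 + k)%nat)) <= s2 k).
    rewrite Rabs_pos_eq by apply Cmod_ge_0.
    unfold s2. rewrite (Nat.add_comm 2 k).
    assert (H1 : 1 <= INR (k + 2)) by (apply (le_INR 1); lia).
    generalize (Cmod_ge_0 (b (k + 2)%nat)). nra. }
  assert (HinU : forall z, in_U z -> Rbar_lt (Cmod z) (CV_radius (fun k => Cmod (b k)))).
  { intros z Hz. now apply Rbar_lt_le_trans with (2 := Hrad). }
  assert (Hd1 : forall z, in_U z -> is_Cderive f z (CPSeries (CPS_derive b) z)).
  { intros z Hz. apply (is_derive_ext (CPSeries b)); [easy|].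
    now apply is_derive_CPSeries, HinU. }
  assert (HC1 : forall z, in_U z -> C_derive f z = CPSeries (CPS_derive b) z).
  { intros z Hz. now apply is_C_derive_unique, Hd1. }
  assert (HC2 : forall z, in_U z ->
    C_derive (C_derive f) z = CPSeries (CPS_derive (CPS_derive b)) z).
  { intros z Hz. apply is_C_derive_unique.
    (* The first derivative is identified with its series only on the disk, so openness of the disk
       is used to differentiate again. *)
    apply (is_derive_ext_loc (CPSeries (CPS_derive b))).
    - generalize (ball_in_U z Hz). apply filter_imp. intros w Hw. now rewrite HC1.
    - apply is_derive_CPSeries. rewrite CV_radius_CPS_derive. now apply HinU. }
  split; [split|].
  { intros z Hz. eexists. now apply Hd1. }
  { exists b. intros z Hz.
    apply is_series_ext with (fun k => (b (2 + k)%nat * z ^ (2 + k))%C).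
    { intros k. now rewrite (Nat.add_comm k 2). }
    apply (is_series_incr_n (fun k => (b k * z ^ k)%C)); [lia|].
    replace (plus _ _) with (CPSeries b z); [now apply is_Cseries_CPSeries, HinU|].
    simpl pred. rewrite sum_Sn, sum_O, Hf, Hb0, Hb1.
    change (@eq C (CPSeries b z) (CPSeries b z - z + (0 * 1 + 1 * (z * 1)))%C). ring. }
  intros z Hz. rewrite HC1, HC2 by easy.
  set (f1 := CPSeries (CPS_derive b) z).
  set (f2 := CPSeries (CPS_derive (CPS_derive b)) z).
  set (r := Cmod z). assert (Hr : 0 <= r < 1) by (split; [apply Cmod_ge_0 | exact Hz]).
  assert (Hpow : forall k, 0 <= r ^ k <= 1).
  { intros k. split; [now apply pow_le|]. rewrite <- (pow1 k). apply pow_incr. lra. }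
  assert (B2 : Cmod f2 <= S1).
  { refine (is_Cseries_Cmod_le _ s1 _ _ (is_Cseries_CPSeries _ z _) (Series_correct _ Hex1) _).
    - rewrite !CV_radius_CPS_derive. now apply HinU.
    - intros k. unfold CPS_derive, s1.
      rewrite !Cmod_mult, Cmod_pow, !Cmod_R, !Rabs_pos_eq by apply pos_INR.
      replace (k + 2)%nat with (S (S k)) by lia. replace (k + 1)%nat with (S k) by lia.
      fold r. destruct (Hpow k).
      assert (0 <= INR (S k) * (INR (S (S k)) * Cmod (b (S (S k))))).
      { repeat apply Rmult_le_pos; try apply pos_INR; apply Cmod_ge_0. }
      nra. }
  (* The constant coefficient of f' is 1, so f' - 1 starts in degree one and a factor [r] comes
     out. *)
  assert (B1 : Cmod (f1 - 1) <= r * S2).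
  { refine (is_Cseries_Cmod_le (fun k => (CPS_derive b (S k) * z ^ S k)%C)
              (fun k => r * s2 k) _ _ _ (is_series_scal_l r _ _ (Series_correct _ Hex2)) _).
    - apply (is_series_incr_1 (fun k => (CPS_derive b k * z ^ k)%C)).
      replace (plus _ _) with f1.
      + apply is_Cseries_CPSeries. rewrite CV_radius_CPS_derive. now apply HinU.
      + unfold CPS_derive at 1. rewrite Hb1.
        change (@eq C f1 (f1 - 1 + 1 * 1 * 1)%C). ring.
    - intros k. unfold CPS_derive, s2.
      rewrite !Cmod_mult, Cmod_pow, !Cmod_R, !Rabs_pos_eq by apply pos_INR.
      replace (k + 2)%nat with (S (S k)) by lia.
      fold r. destruct (Hpow k). simpl pow.
      assert (0 <= INR (S (S k)) * Cmod (b (S (S k)))).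
      { repeat apply Rmult_le_pos; try apply pos_INR; apply Cmod_ge_0. }
      assert (0 <= INR (S (S k)) * Cmod (b (S (S k))) * r) by (apply Rmult_le_pos; lra).
      nra. }
  (* Since S1 >= 0 and D > 0, [HS] forces S2 <= 1; a zero of f' would then give 1 <= r S2 < 1. *)
  assert (HS2 : S2 <= 1) by nra.
  set (T := (z * f2)%C).
  assert (BT : Cmod T <= r * S1).
  { unfold T. rewrite Cmod_mult. fold r. nra. }
  assert (Hf1 : f1 <> 0).
  { intros E. rewrite E in B1. replace (0 - 1)%C with (- (1))%C in B1 by ring.
    rewrite Cmod_m1 in B1. nra. }
  (* This is the denominator of the class condition multiplied by f'(z), so the quotient to be
     bounded becomes T / d. *)
  set (d := (T + 2 * (1 - RtoC alpha) * f1)%C).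
  assert (Hd : Cmod T < beta * Cmod d).
  { assert (H : 2 * (1 - alpha) <= Cmod d + Cmod T + 2 * (1 - alpha) * Cmod (f1 - 1)).
    { rewrite <- (Cmod_opp T), <- (Cmod_opp (f1 - 1)).
      rewrite <- (Rabs_pos_eq (2 * (1 - alpha))) by lra. rewrite <- Cmod_R, <- Cmod_mult.
      replace (RtoC (2 * (1 - alpha)))
        with (d + - T + RtoC (2 * (1 - alpha)) * - (f1 - 1))%C at 1
        by (unfold d; rewrite RtoC_mult, RtoC_minus; ring).
      apply Rle_trans with (1 := Cmod_triangle _ _).
      apply Rplus_le_compat_r, Cmod_triangle. }
    assert (Hb : D <= beta * Cmod d + beta * Cmod T + D * Cmod (f1 - 1)).
    { unfold D. replace (2 * beta * (1 - alpha)) with (beta * (2 * (1 - alpha))) by ring. nra. }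
    assert ((1 + beta) * Cmod T + D * Cmod (f1 - 1) < D); [|lra].
    (* [BT] and [B1] give the first bound; [HS] and r < 1 bound the middle term by r D < D. *)
    apply Rle_lt_trans with (r * ((1 + beta) * S1 + D * S2)); nra. }
  assert (Hd0 : d <> 0).
  { intros E. rewrite E, Cmod_0 in Hd. generalize (Cmod_ge_0 T). lra. }
  cbv zeta. fold T.
  replace (T / f1 + 2 * (1 - RtoC alpha))%C with (d / f1)%C by (unfold d; now field).
  split; [easy|]. split.
  { intros E. apply Hd0. replace d with (d / f1 * f1)%C by now field. rewrite E. ring. }
  replace (T / f1 / (d / f1))%C with (T / d)%C by now field.
  rewrite Cmod_div by easy.
  apply Rmult_lt_reg_r with (Cmod d); [now apply Cmod_gt_0|].
  unfold Rdiv. rewrite Rmult_assoc, Rinv_l, Rmult_1_r; [easy|].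
  apply Rgt_not_eq, Cmod_gt_0, Hd0.
Qed.

(** * Exponential sums and bounds for the Bessel coefficients *)

Lemma is_series_exp_ID (t : R) :
  is_series (fun k => INR k * t ^ k / INR (fact k)) (t * exp t).
Proof.
  (* The term k = 0 vanishes, and k / k! = 1 / (k - 1)! for the others: t times the exponential
     series remains. *)
  apply is_series_decr_1.
  replace (plus _ _) with (t * exp t)
    by (change (t * exp t = t * exp t + - (0 * 1 / INR (fact 0))); simpl; field).
  refine (is_series_ext _ _ _ _ (is_series_scal_l t _ _ (proj1 (is_pseries_R _ _ _) (is_exp_Reals t)))).
  intros n. change (t * (/ INR (fact n) * t ^ n) = INR (S n) * (t * t ^ n) / INR (fact (S n))).
  rewrite fact_simpl, mult_INR. field. split; [apply INR_fact_neq_0 | now apply not_0_INR].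
Qed.

(** The same shift, with k^2 / k! = ((k - 1) + 1) / (k - 1)!, reduces this to the two preceding
    sums. *)
Lemma is_series_exp_sqr (t : R) :
  is_series (fun k => INR k * INR k * t ^ k / INR (fact k)) ((t ^ 2 + t) * exp t).
Proof.
  apply is_series_decr_1.
  replace (plus _ _) with (t * (t * exp t + exp t))
    by (change (t * (t * exp t + exp t) = (t ^ 2 + t) * exp t + - (0 * 0 * 1 / INR (fact 0)));
        simpl; field).
  refine (is_series_ext _ _ _ _ (is_series_scal_l t _ _ (is_series_plus _ _ _ _ (is_series_exp_ID t)
    (proj1 (is_pseries_R _ _ _) (is_exp_Reals t))))).
  intros n.
  change (t * (INR n * t ^ n / INR (fact n) + / INR (fact n) * t ^ n)
          = INR (S n) * INR (S n) * (t * t ^ n) / INR (fact (S n))).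
  rewrite fact_simpl, mult_INR.
  assert (INR (S n) <> 0) by now apply not_0_INR.
  rewrite S_INR in *. field. split; [apply INR_fact_neq_0 | easy].
Qed.

(** The first factor is m, and each later factor m + j has j >= 1. *)
Lemma Cmod_pochhammer_ge (m : R) (k : nat) :
  0 < m -> m * (m + 1) ^ k <= Cmod (pochhammer (RtoC m) (S k)).
Proof.
  intros Hm.
  assert (E : forall j, Cmod (RtoC m + RtoC (INR j)) = m + INR j).
  { intros j. rewrite <- RtoC_plus, Cmod_R. apply Rabs_pos_eq.
    generalize (pos_INR j). lra. }
  induction k as [|k IH].
  - cbn [pochhammer]. rewrite Cmod_mult, E, Cmod_1. simpl. lra.
  - change (pochhammer (RtoC m) (S (S k)))
      with (pochhammer (RtoC m) (S k) * (RtoC m + RtoC (INR (S k))))%C.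
    rewrite Cmod_mult, E. simpl pow.
    replace (m * ((m + 1) * (m + 1) ^ k)) with (m * (m + 1) ^ k * (m + 1)) by ring.
    assert (0 <= (m + 1) ^ k) by (apply pow_le; lra).
    apply Rmult_le_compat; [nra | lra | exact IH |].
    rewrite S_INR. generalize (pos_INR k). lra.
Qed.

(** Indexed by the power of z, hence shifted by one against the series defining [bessel_u], whose
    k-th term has degree k + 1. *)
Definition bessel_coef (p b c : C) (k : nat) : C :=
  match k with
  | O => RtoC 0
  | S j => ((- c) ^ j / pochhammer (kappa p b) j / RtoC (INR (fact j)))%C
  end.

Lemma bessel_u_CPSeries (p b c z : C) : bessel_u p b c z = CPSeries (bessel_coef p b c) z.
Proof.
  unfold bessel_u, CPSeries, CSeries. f_equal.
  - rewrite (Series_incr_1_aux (fun k => Re (bessel_coef p b c k * z ^ k)%C)).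
    + apply Series_ext. intros n. f_equal. rewrite Nat.add_1_r. unfold bessel_coef, Cdiv. ring.
    + simpl. ring.
  - rewrite (Series_incr_1_aux (fun k => Im (bessel_coef p b c k * z ^ k)%C)).
    + apply Series_ext. intros n. f_equal. rewrite Nat.add_1_r. unfold bessel_coef, Cdiv. ring.
    + simpl. ring.
Qed.

(** The factor (m + 1) / m compensates for the first Pochhammer factor being m instead of m + 1. *)
Lemma Cmod_bessel_coef_le (p b : C) (x m : R) (k : nat) :
  x <= 0 -> 0 < m -> kappa p b = RtoC m ->
  Cmod (bessel_coef p b (RtoC x) (k + 2)) <=
    (m + 1) / m * (((- x) / (m + 1)) ^ S k / INR (fact (S k))).
Proof.
  intros Hx Hm Hk. replace (k + 2)%nat with (S (S k)) by lia.
  unfold bessel_coef. rewrite Hk.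
  assert (HP := Cmod_pochhammer_ge m k Hm).
  assert (Hp : 0 < m * (m + 1) ^ k) by (apply Rmult_lt_0_compat; [easy | apply pow_lt; lra]).
  assert (Hf := INR_fact_lt_0 (S k)).
  rewrite !Cmod_div, Cmod_pow, Cmod_opp, !Cmod_R.
  - rewrite (Rabs_left1 x), (Rabs_pos_eq (INR _)) by lra.
    replace ((m + 1) / m * ((- x / (m + 1)) ^ S k / INR (fact (S k))))
      with ((- x) ^ S k / (m * (m + 1) ^ k) / INR (fact (S k))).
    + apply Rmult_le_compat_r; [left; now apply Rinv_0_lt_compat|].
      apply Rmult_le_compat_l; [apply pow_le; lra|].
      now apply Rinv_le_contravar.
    + unfold Rdiv. rewrite Rpow_mult_distr, pow_inv. simpl pow. field.
      repeat split; try lra. apply pow_nonzero. lra.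
  - intros E. rewrite E, Cmod_0 in HP. lra.
  - intros E. apply RtoC_inj in E. lra.
Qed.

(** * The Bessel function: evaluating the majorant and comparing it with D *)

Theorem theorem2 (alpha beta : R) (p b c : C) (x m : R)
  (halpha : 0 <= alpha < 1) (hbeta : 0 < beta <= 1)
  (hc : c = RtoC x) (hx : x < 0)
  (hkappa : kappa p b = RtoC m) (hm : 0 < m)
  (hcond :
    2 * beta * (1 - alpha) * (1 + (m + 1) / m) * exp (x / (m + 1))
    - ((1 + beta) * x ^ 2 / (m * (m + 1))
       - 2 * (1 + beta * (2 - alpha)) * x / m
       + 2 * beta * (1 - alpha) * (m + 1) / m) >= 0) :
  class_K alpha beta (bessel_u p b c).
Proof.
  subst c. set (D := 2 * beta * (1 - alpha)). set (t := - x / (m + 1)).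
  assert (HD : 0 < D) by (unfold D; apply Rmult_lt_0_compat; lra).
  (* [major n] bounds the weighted coefficient of z^(n+1) for n >= 1. Its value at n = 0 is D (m +
     1) / m, which [Htail] removes. *)
  set (major := fun n =>
    (m + 1) / m * ((INR n + 1) * (INR n * (1 + beta) + D) * (t ^ n / INR (fact n)))).
  assert (Hmajor : is_series major
    ((m + 1) / m * ((1 + beta) * (t ^ 2 + 2 * t) * exp t + D * (t * exp t + exp t)))).
  { assert (E0 : is_series (fun n => t ^ n / INR (fact n)) (exp t)).
    { refine (is_series_ext _ _ _ _ (proj1 (is_pseries_R _ _ _) (is_exp_Reals t))).
      intros n. apply Rmult_comm. }
    (* Expansion (n + 1) (n (1 + beta) + D) = (1 + beta) n^2 + (1 + beta + D) n + D, one exponential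
       sum for each power of n. *)
    assert (H := is_series_scal_l ((m + 1) / m) _ _
      (is_series_plus _ _ _ _
        (is_series_plus _ _ _ _
          (is_series_scal_l (1 + beta) _ _ (is_series_exp_sqr t))
          (is_series_scal_l (1 + beta + D) _ _ (is_series_exp_ID t)))
        (is_series_scal_l D _ _ E0))).
    match type of H with is_series _ ?l =>
      replace ((m + 1) / m * ((1 + beta) * (t ^ 2 + 2 * t) * exp t + D * (t * exp t + exp t))) with l end.
    - refine (is_series_ext _ _ _ _ H). intros n.
      change ((m + 1) / m * ((1 + beta) * (INR n * INR n * t ^ n / INR (fact n))
        + (1 + beta + D) * (INR n * t ^ n / INR (fact n)) + D * (t ^ n / INR (fact n))) = major n).
      unfold major, Rdiv. ring.
    - change ((m + 1) / m * ((1 + beta) * ((t ^ 2 + t) * exp t)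
        + (1 + beta + D) * (t * exp t) + D * exp t)
        = (m + 1) / m * ((1 + beta) * (t ^ 2 + 2 * t) * exp t + D * (t * exp t + exp t))).
      ring. }
  assert (Htail : is_series (fun k => major (S k))
    ((m + 1) / m * ((1 + beta) * (t ^ 2 + 2 * t) * exp t + D * (t * exp t + exp t) - D))).
  { apply is_series_incr_1.
    match type of Hmajor with is_series _ ?l => replace (plus _ _) with l; [exact Hmajor|] end.
    change ((m + 1) / m * ((1 + beta) * (t ^ 2 + 2 * t) * exp t + D * (t * exp t + exp t)) =
      (m + 1) / m * ((1 + beta) * (t ^ 2 + 2 * t) * exp t + D * (t * exp t + exp t) - D) + major 0%nat).
    unfold major. simpl. field. lra. }
  set (s := fun k => INR (k + 2) * (INR (k + 1) * (1 + beta) + D)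
                     * Cmod (bessel_coef p b (RtoC x) (k + 2)%nat)).
  assert (Hs : forall k, 0 <= s k <= major (S k)).
  { intros k.
    assert (H0 : 0 <= INR (k + 2) * (INR (k + 1) * (1 + beta) + D)).
    { apply Rmult_le_pos; [apply pos_INR|]. generalize (pos_INR (k + 1)). nra. }
    split; [apply Rmult_le_pos; [exact H0 | apply Cmod_ge_0]|].
    replace (major (S k)) with (INR (k + 2) * (INR (k + 1) * (1 + beta) + D)
      * ((m + 1) / m * (t ^ S k / INR (fact (S k))))).
    - apply Rmult_le_compat_l; [exact H0|]. apply Cmod_bessel_coef_le; [lra | easy..].
    - unfold major. rewrite <- (S_INR (S k)).
      replace (k + 2)%nat with (S (S k)) by lia. replace (k + 1)%nat with (S k) by lia. ring. }
  apply class_K_of_coefficients with (bessel_coef p b (RtoC x)).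
  - exact halpha.
  - apply hbeta.
  - reflexivity.
  - simpl. field.
  - apply bessel_u_CPSeries.
  - apply (ex_series_le (V := R_CompleteNormedModule) _ (fun k => major (S k))); [|eexists; exact Htail].
    intros k. change (Rabs (s k) <= major (S k)). rewrite Rabs_pos_eq; apply Hs.
  - fold D. fold s. apply Rle_trans with (Series (fun k => major (S k))).
    { apply Series_le; [exact Hs | eexists; exact Htail]. }
    rewrite (is_series_unique _ _ Htail).
    replace (x / (m + 1)) with (- t) in hcond by (unfold t; field; lra).
    assert (Hx : x = - (t * (m + 1))) by (unfold t; field; lra).
    assert (He : exp t * exp (- t) = 1) by (rewrite <- exp_plus, Rplus_opp_r; apply exp_0).
    (* The factor exp t cancels exp (- t). With x = - t (m + 1), the tail sum minus D is then
       exactly the negative of the scaled left-hand side. *)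
    assert (Hscaled := Rmult_le_compat_l (exp t) _ _ (Rlt_le _ _ (exp_pos t)) (Rge_le _ _ hcond)).
    apply Rminus_le.
    match type of Hscaled with _ <= ?u => apply Rle_trans with (- u); [|lra] end.
    fold D. rewrite Hx.
    apply Req_le.
    match goal with |- _ = - (exp t * (_ * exp (- t) - ?v)) => 
      replace (- (exp t * (D * (1 + (m + 1) / m) * exp (- t) - v)))
        with (exp t * v - D * (1 + (m + 1) / m) * (exp t * exp (- t))) by ring end.
    rewrite He. unfold D. field. lra.
Qed.
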